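(* Let $S$ be a finite non-commutative Clifford semigroup. Then the commuting graph $\mathcal{G}(S)$ contains no left paths.
   Context: A semigroup $S$ is a Clifford semigroup if it is equipped with a unary operation $x\mapsto x^{-1}$ such that for all $x,y\in S$: $(x^{-1})^{-1}=x$, $xx^{-1}x=x$, $x^{-1}x=xx^{-1}$, and $(xx^{-1})(yy^{-1})=(yy^{-1})(xx^{-1})$. Equivalently, $S$ is regular and all its idempotents are central. The center of $S$ is $Z(S)=\{x\in S: xy=yx \text{ for all } y\in S\}$. The commuting graph $\mathcal{G}(S)$ of a finite non-commutative semigroup $S$ is the simple graph with vertex set $S\setminus Z(S)$ in which two distinct vertices $x,y$ are adjacent if and only if $xy=yx$. A left path in $\mathcal{G}(S)$ is a path $x_1-x_2-\cdots-x_n$ in $\mathcal{G}(S)$ (pairwise distinct vertices, consecutive ones adjacent) such that $x_1\neq x_n$ and $x_1x_i=x_nx_i$ for all $i\in\{1,\ldots,n\}$. *)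

(* Defs.v *)
From HB Require Import structures.
From mathcomp Require Import all_boot.

Set Implicit Arguments.
Unset Strict Implicit.
Unset Printing Implicit Defensive.

Local Open Scope group_scope.

#[short(type="finSemigroupType")]
HB.structure Definition FinSemigroup := {S of Semigroup S & Finite S}.

Record is_clifford (S : semigroupType) (inv : S -> S) : Prop := IsClifford {
  clifford_invK : forall x, inv (inv x) = x;
  clifford_mulKV : forall x, x * inv x * x = x;
  clifford_mulVC : forall x, inv x * x = x * inv x;
  clifford_idemC : forall x y,
    (x * inv x) * (y * inv y) = (y * inv y) * (x * inv x)
}.

Definition scenter (S : finSemigroupType) : {set S} :=
  [set x : S | [forall y : S, x * y == y * x]].

Definition cgraph_vertex (S : finSemigroupType) : finType :=
  {x : S | x \notin scenter S}.

Definition cgraph_adj (S : finSemigroupType) : rel (cgraph_vertex S) :=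
  fun x y => (x != y) && (val x * val y == val y * val x).

(* The sequence x :: p is x_1, ..., x_n, so that last x p is x_n. *)
Definition left_path (S : finSemigroupType) (x : cgraph_vertex S)
    (p : seq (cgraph_vertex S)) : bool :=
  [&& path (@cgraph_adj S) x p, uniq (x :: p), x != last x p
    & all (fun y => val x * val y == val (last x p) * val y) (x :: p)].

(* Main.v *)
(* In a Clifford semigroup write e_x = x x^-1, so that x e_x = x. A left path from a to b gives
   a a = b a and a b = b b, hence a = a e_a = b e_a and b = b e_b = a e_b.
   Since e_a and e_b commute, a = b e_a = a e_b e_a = a e_a e_b = a e_b = b. *)
Require Import Defs.
From mathcomp Require Import all_boot.

Local Open Scope group_scope.

(** Since [inv x] commutes with [x], the left side is [x * inv x * x]. *)
Lemma clifford_mulKid (S : semigroupType) (inv : S -> S)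
    (S_clifford : is_clifford inv) (x : S) :
  x * (x * inv x) = x.
Proof.
by rewrite -(clifford_mulVC S_clifford) mulgA (clifford_mulKV S_clifford).
Qed.

(** The hypotheses are the left-path equation at its two endpoints, with a = x_1 and b = x_n. *)
Lemma clifford_left_eq (S : semigroupType) (inv : S -> S)
    (S_clifford : is_clifford inv) (a b : S) :
  a * a = b * a -> a * b = b * b -> a = b.
Proof.
move=> aa_ba ab_bb.
have aE : b * (a * inv a) = a.
  by rewrite mulgA -aa_ba -mulgA (clifford_mulKid _ _ S_clifford).
have bE : a * (b * inv b) = b.
  by rewrite mulgA ab_bb -mulgA (clifford_mulKid _ _ S_clifford).
(* Only the left side is expanded, to a e_b e_a; swapping the idempotents lets a absorb e_a, which
   leaves [bE]. *)
rewrite -{1}aE -{1}bE -mulgA (clifford_idemC S_clifford) mulgA.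
by rewrite (clifford_mulKid _ _ S_clifford).
Qed.

Theorem theorem6p1 (S : finSemigroupType) (inv : S -> S)
    (S_clifford : is_clifford inv)
    (S_noncomm : ~ (forall x y : S, x * y = y * x)) :
  ~ (exists (x : cgraph_vertex S) (p : seq (cgraph_vertex S)), left_path x p).
Proof.
case=> x [p /and4P[_ _ /eqP x_neq_last /allP left_eq]].
(* Vertices with equal values in [S] coincide; [left_eq] is used at [x] and at [last x p]. *)
apply/x_neq_last/val_inj/(clifford_left_eq _ _ S_clifford); apply/eqP/left_eq.
  exact: mem_head.
exact: mem_last.
Qed.
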